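(* Let $p>3$ be a prime, let $a\in\mathbb{Z}_p$ with $a\not\equiv 0\pmod p$, let $\langle a\rangle_p$ be the least nonnegative residue of $a$ modulo $p$, and let $t=(a-\langle a\rangle_p)/p$. Then $$\sum_{k=0}^{(p-1)/2}\binom ak\binom{-1-a}k\equiv\begin{cases}\sum_{k=0}^{p-1}\binom ak(-2)^k\pmod{p^2}&\text{if }\langle a\rangle_p\le\frac{p-1}2,\\ \big(1+\frac1t\big)\sum_{k=0}^{p-1}\binom ak(-2)^k-(-1)^{\langle a\rangle_p}\frac1t\pmod{p^2}&\text{if }\langle a\rangle_p>\frac{p-1}2\text{ and }t\not\equiv0\pmod p,\\ (-1)^{\langle a\rangle_p}-pE_{p-2}(-a)\pmod{p^2}&\text{if }\langle a\rangle_p>\frac{p-1}2\text{ and }t\equiv0\pmod p.\end{cases}$$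
   Context: $\mathbb{Z}_p$ denotes the set of rational numbers whose denominator is not divisible by $p$; congruences modulo $p^m$ are taken in $\mathbb{Z}_p$ (i.e. $x\equiv y$ means $x-y\in p^m\mathbb{Z}_p$). For $a\in\mathbb{Z}_p$, $\langle a\rangle_p\in\{0,1,\dots,p-1\}$ satisfies $\langle a\rangle_p\equiv a\pmod p$. $\binom xk=x(x-1)\cdots(x-k+1)/k!$. The Euler numbers are defined by $E_0=1$, $E_n=-\sum_{k=1}^{[n/2]}\binom n{2k}E_{n-2k}$ ($n\ge1$), and the Euler polynomials by $E_n(x)=2^{-n}\sum_{r=0}^n\binom nr(2x-1)^{n-r}E_r$. *)

(* Defs.v *)
From HB Require Import structures.
From mathcomp Require Import all_boot all_order all_algebra ring.
Set Implicit Arguments.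
Unset Strict Implicit.
Unset Printing Implicit Defensive.
Import Order.TTheory GRing.Theory Num.Theory.
Local Open Scope ring_scope.

(* [denq x] is the denominator of [x] in lowest terms. *)
Definition plocal (p : nat) : pred rat := [pred x | ~~ (p %| `|denq x|)%N].

(* For [p > 0] this is [x - y \in p^m Z_(p)]. *)
Definition pcong (p m : nat) (x y : rat) : bool :=
  (x - y) / p%:R ^+ m \in plocal p.

Lemma pcongP (p m : nat) (x y : rat) : (0 < p)%N ->
  reflect (exists2 z, z \in plocal p & x - y = p%:R ^+ m * z) (pcong p m x y).
Proof.
move=> p0; have pm0 : (p%:R : rat) ^+ m != 0.
  by rewrite expf_neq0 // pnatr_eq0 -lt0n.
apply: (iffP idP) => [h|[z hz e]].
  by exists ((x - y) / p%:R ^+ m) => //; rewrite mulrC divfK.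
by rewrite /pcong e mulrC mulKf.
Qed.

(* The junk value [p] is never reached when [p] is prime and [a] is p-local:
   see [presidueP]. *)
Definition presidue (p : nat) (a : rat) : nat :=
  find (fun r : nat => pcong p 1 a r%:R) (iota 0 p).

Lemma presidueP (p : nat) (a : rat) : prime p -> a \in plocal p ->
  (presidue p a < p)%N /\ pcong p 1 a (presidue p a)%:R.
Proof.
move=> pp ap.
suff hasr : has (fun r : nat => pcong p 1 a r%:R) (iota 0 p).
  have lt : (presidue p a < p)%N by move: hasr; rewrite has_find size_iota.
  split=> //; have := nth_find 0%N hasr.
  by rewrite nth_iota.
have p0 : (0 < p)%N := prime_gt0 pp.
have cop : coprimez (denq a) p%:Z.
  by rewrite coprimezE /= coprime_sym prime_coprime.
have [[u v] /= uv] : exists w : int * int, w.1 * denq a + w.2 * p%:Z = 1.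
  by case/coprimezP: cop => -[u v] /= e; exists (u, v).
set z : int := numq a * u.
have zr : (0 <= (z %% p%:Z)%Z) by rewrite modz_ge0 // eqz_nat -lt0n.
have zlt : (z %% p%:Z)%Z < p%:Z by rewrite ltz_pmod.
apply/hasP; exists `|(z %% p%:Z)%Z|%N.
  by rewrite mem_iota /= add0n -ltz_nat gez0_abs.
have rE : (`|(z %% p%:Z)%Z|%N%:R : rat) = ((z %% p%:Z)%Z)%:~R.
  by rewrite -[LHS]/(`|_|%N%:~R) -pmulrn natr_absz ger0_norm.
have d0 : ((denq a)%:~R : rat) != 0 by rewrite intr_eq0 denq_neq0.
apply/pcongP => //.
exists ((numq a * v + (z %/ p%:Z)%Z * denq a)%:~R / (denq a)%:~R).
  rewrite !inE; apply: contra ap => /dvdn_trans; apply.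
  set w := (_ + _ : int).
  have [s _ [nE dE]] : exists2 s : int, s != 0 &
      w = s * numq (w%:~R / (denq a)%:~R) /\
      denq a = s * denq (w%:~R / (denq a)%:~R).
    case: (divqP w (denq a)); first by move=> e; move: (denq_neq0 a); rewrite e eqxx.
    by move=> k x k0; exists k.
  by rewrite [X in (_ %| `|X|)%N]dE abszM dvdn_mull.
rewrite rE expr1; apply: (mulIf d0); rewrite mulrA divfK // mulrBl.
rewrite -{1}[a]divq_num_den divfK // -!(rmorphM, rmorphB) -[p%:R]/(p%:~R).
rewrite -rmorphM; congr (_%:~R).
have zE := divz_eq z p%:Z.
have -> : (z %% p%:Z)%Z = z - (z %/ p%:Z)%Z * p%:Z by rewrite [X in X - _]zE addrC addKr.
rewrite -{1}[numq a]mulr1 -uv /z; ring.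
Qed.

Definition rbinom (x : rat) (k : nat) : rat :=
  (\prod_(i < k) (x - i%:R)) / k`!%:R.

(* [euler_seq n] is the list [:: E_0; ...; E_n]. *)
Fixpoint euler_seq (n : nat) : seq rat :=
  if n is m.+1 then
    let s := euler_seq m in
    rcons s (- \sum_(1 <= k < (n./2).+1) 'C(n, k.*2)%:R * s`_(n - k.*2))
  else [:: 1].

Definition euler_num (n : nat) : rat := (euler_seq n)`_n.

Lemma size_euler_seq n : size (euler_seq n) = n.+1.
Proof. by elim: n => //= n IH; rewrite size_rcons IH. Qed.

Lemma nth_euler_seq n i : (i <= n)%N -> (euler_seq n)`_i = euler_num i.
Proof.
elim: n => [|n IH]; first by rewrite leqn0 => /eqP ->.
rewrite leq_eqVlt => /predU1P [-> //|lt_in].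
by rewrite /= nth_rcons size_euler_seq lt_in IH.
Qed.

Lemma euler_num0 : euler_num 0 = 1.
Proof. by []. Qed.

Lemma euler_numE n : (0 < n)%N ->
  euler_num n =
  - \sum_(1 <= k < (n./2).+1) 'C(n, k.*2)%:R * euler_num (n - k.*2).
Proof.
case: n => // n _.
rewrite {1}/euler_num [euler_seq _]/= nth_rcons size_euler_seq ltnn eqxx.
congr (- _); apply: eq_big_nat => k /andP [k1 _].
rewrite nth_euler_seq //; case: k k1 => // k _.
by rewrite doubleS subSS leq_subLR addSn leqW // leq_addl.
Qed.

Definition euler_poly (n : nat) (x : rat) : rat :=
  2 ^- n * \sum_(0 <= r < n.+1)
    'C(n, r)%:R * (2 * x - 1) ^+ (n - r) * euler_num r.

(* Main.v *)
(* Write p = 2 n + 1 and a = r + p t, and let L(a), S(a) be the two sums.  Both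
   satisfy telescoping recurrences,
     L(a) + L(a - 1) = 2 binom(a - 1, n) binom(-1 - a, n),
     S(a) + S(a - 1) = 2 (-2)^(p - 1) binom(a - 1, p - 1),
   whence L(r) = (-1)^r for r <= n and S(r) = (-1)^r for r < p.  Modulo p^2 both
   are linear in t, so it remains to find their slopes.  The recurrences say that
   the slope q(r) of S satisfies q(r) + q(r - 1) == 2 p / r for 0 < r < p, that of
   L the same for 0 < r <= n, and so does - p E_(p-2)(-r), because
   E_k(x) + E_k(x + 1) = 2 x^k and by Fermat.  All three vanish at r = n: the slope
   of L by the symmetry L(-1 - a) = L(a), that of S because
   q(r) + q(p - 1 - r) == 0 (which follows from its value at r = 0 and r = p - 1),
   and the Euler term because -n == 1/2 and the Euler number
   E_(p-2) is 0.  Hence they agree.  The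
   case r > n reduces to r <= n by the symmetry of L. *)
Require Import Defs.
From HB Require Import structures.
From mathcomp Require Import all_boot all_order all_algebra.
From mathcomp Require Import cyclic ring zify.
Import Order.TTheory GRing.Theory Num.Theory.
Local Open Scope ring_scope.

Set Implicit Arguments.
Unset Strict Implicit.

(** * Generalized binomial coefficients and the two sums *)

Section Binomial.

Implicit Types (x a : rat) (k n : nat).

Lemma rbinom0 x : rbinom x 0 = 1.
Proof. by rewrite /rbinom big_ord0 fact0 divr1. Qed.

Lemma rbinomS x k : rbinom x k.+1 = rbinom x k * (x - k%:R) / k.+1%:R.
Proof.
by rewrite /rbinom big_ord_recr factS natrM invfM /=; ring.
Qed.

Lemma rbinomSl x k : rbinom x k.+1 = x / k.+1%:R * rbinom (x - 1) k.
Proof.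
rewrite /rbinom big_ord_recl factS natrM /= subr0.
under eq_bigr do rewrite /bump /= add1n -natr1 opprD [- _ - 1]addrC addrA.
by rewrite invfM; ring.
Qed.

Lemma rbinom_pascal x k : rbinom x k.+1 = rbinom (x - 1) k.+1 + rbinom (x - 1) k.
Proof. by rewrite rbinomSl rbinomS -natr1; field; rewrite natr1 pnatr_eq0. Qed.

Lemma rbinom_nat n k : rbinom n%:R k = 'C(n, k)%:R.
Proof.
elim: n k => [|n IH] [|k]; rewrite ?rbinom0 ?bin0 //.
  by rewrite rbinomSl !mul0r.
by rewrite rbinom_pascal -natr1 addrK !IH -natrD binS.
Qed.

Lemma rbinomN x k : rbinom (- x) k = (-1) ^+ k * rbinom (x + k%:R - 1) k.
Proof.
elim: k x => [|k IH] x; first by rewrite !rbinom0 mulr1.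
rewrite rbinomSl -opprD IH rbinomS exprS -natr1.
have -> : x + 1 + k%:R - 1 = x + k%:R by ring.
have -> : x + (k%:R + 1) - 1 = x + k%:R by ring.
by field; rewrite natr1 pnatr_eq0.
Qed.

Definition binom_prod_sum n a : rat :=
  \sum_(0 <= k < n.+1) rbinom a k * rbinom (-1 - a) k.

Definition binom_pow_sum n a : rat := \sum_(0 <= k < n.+1) rbinom a k * (-2) ^+ k.

Lemma binom_prod_sum_sym n a : binom_prod_sum n (-1 - a) = binom_prod_sum n a.
Proof. by apply: eq_bigr => k _; rewrite mulrC opprB addrC subrK. Qed.

(** Telescoping in the upper limit [n]: the two terms of index [k + 1] add up to the increment of
    the right-hand side from [k] to [k + 1]. *)
Lemma binom_prod_sum_rec n a :
  binom_prod_sum n a + binom_prod_sum n (a - 1) =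
  2 * (rbinom (a - 1) n * rbinom (-1 - a) n).
Proof.
rewrite /binom_prod_sum; have -> : -1 - (a - 1) = - a by ring.
elim: n => [|n IH]; first by rewrite !big_nat1 !rbinom0; ring.
rewrite big_nat_recr //= [X in _ + X]big_nat_recr //= addrACA IH.
rewrite [rbinom a _]rbinomSl [rbinom (- a) _]rbinomSl !rbinomS.
have -> : - a - 1 = -1 - a by ring.
by rewrite -[n.+1%:R]natr1; field; rewrite addrC nat1r pnatr_eq0.
Qed.

Lemma binom_pow_sum_rec n a :
  binom_pow_sum n a + binom_pow_sum n (a - 1) = 2 * (rbinom (a - 1) n * (-2) ^+ n).
Proof.
rewrite /binom_pow_sum.
elim: n => [|n IH]; first by rewrite !big_nat1 !rbinom0; ring.
rewrite big_nat_recr //= [X in _ + X]big_nat_recr //= addrACA IH rbinom_pascal.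
by rewrite exprS; ring.
Qed.

(** For [0 < r <= n] the recurrence has right-hand side 0, because [r - 1 < n] kills the binomial;
    the value 1 at [r = 0] then only alternates in sign. *)
Lemma binom_prod_sum_nat n (r : nat) :
  (r <= n)%N -> binom_prod_sum n r%:R = (-1) ^+ r.
Proof.
elim: r => [_|r IH rn].
  rewrite /binom_prod_sum big_nat_recl //= !rbinom0 big1_seq ?addr0 ?mulr1 //.
  by move=> k _; rewrite (rbinom_nat 0) mul0r.
have := binom_prod_sum_rec n r.+1%:R.
rewrite -natr1 addrK IH ?(ltnW rn) // rbinom_nat bin_small // mul0r mulr0.
by move/eqP; rewrite addr_eq0 => /eqP ->; rewrite exprS mulN1r.
Qed.

Lemma binom_pow_sum_nat n (r : nat) :
  (r <= n)%N -> binom_pow_sum n r%:R = (-1) ^+ r.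
Proof.
elim: r => [_|r IH rn].
  rewrite /binom_pow_sum big_nat_recl //= rbinom0 big1_seq ?addr0 ?mulr1 //.
  by move=> k _; rewrite (rbinom_nat 0) mul0r.
have := binom_pow_sum_rec n r.+1%:R.
rewrite -natr1 addrK IH ?(ltnW rn) // rbinom_nat bin_small // mul0r mulr0.
by move/eqP; rewrite addr_eq0 => /eqP ->; rewrite exprS mulN1r.
Qed.

(** Both sides are [(2n+1+j)! / (n! n! j!)]. With [p = 2n+1] this exhibits a factor [p] in a product
    of two binomials. *)
Lemma bin_mul_exchange n j :
  ('C(n.*2.+1 + j, n) * 'C(n + j, n) * (n + j).+1 =
   n.*2.+1 * ('C(n.*2.+1 + j, j) * 'C(n.*2, n)))%N.
Proof.
have e1 : (n.*2.+1 + j - n = (n + j).+1)%N by lia.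
have := @bin_fact (n.*2.+1 + j) n; rewrite e1 factS => /(_ ltac:(lia)) h1.
have := bin_fact (leq_addr j n); rewrite addKn => h2.
have := bin_fact (leq_addl n.*2.+1 j); rewrite addnK factS => h3.
have := @bin_fact n.*2 n; rewrite -addnn addnK leq_addr => /(_ isT) h4.
rewrite -addnn in h1 h3 *.
have f0 : (0 < n`! * n`! * j`!)%N by rewrite !muln_gt0 !fact_gt0.
apply/eqP; rewrite -(eqn_pmul2r f0); apply/eqP.
transitivity ((n + n).+1 + j)`!%N.
  by rewrite -h1 -h2; lia.
by rewrite -h3 -h4; lia.
Qed.

End Binomial.

(** * Euler numbers and Euler polynomials *)

Section Euler.

Implicit Types (x z : rat) (n : nat).

Lemma euler_num_int n : euler_num n \is a Num.int.
Proof.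
elim/ltn_ind: n => -[|n] IH; first by rewrite euler_num0 rpred1.
rewrite euler_numE // rpredN big_nat rpred_sum // => k /andP[k_gt0 _].
by rewrite rpredM ?rpred_nat // IH // ltn_subrL double_gt0 k_gt0.
Qed.

Lemma euler_num_odd n : odd n -> euler_num n = 0.
Proof.
elim/ltn_ind: n => -[|n] // IH on.
rewrite euler_numE // big_nat big1 ?oppr0 // => k /andP[k_gt0 kn].
rewrite IH ?mulr0 //; first by case: k k_gt0 {kn} => // k _; lia.
by rewrite oddB ?odd_double ?addbF // -geq_half_double.
Qed.

Lemma sum_sign_even (f : nat -> rat) m :
  \sum_(0 <= j < m) (1 + (-1) ^+ j) * f j =
  2 * \sum_(0 <= k < uphalf m) f k.*2.
Proof.
elim: m => [|m IH]; first by rewrite !big_nil mulr0.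
rewrite big_nat_recr //= IH uphalf_half.
have [om|em] := boolP (odd m); last rewrite !add0n.
  by rewrite -signr_odd om add1n expr1 subrr mul0r addr0.
rewrite big_nat_recr //= mulrDr -signr_odd (negbTE em).
by rewrite even_halfK.
Qed.

(** Coefficient form of [2 cosh(x) * (sum of E_r x^r / r!) = 2]; the factor [1 + (-1)^(n-r)] keeps
    only the terms of the defining recurrence. *)
Lemma euler_num_sum n :
  \sum_(0 <= r < n.+1) (1 + (-1) ^+ (n - r)) * ('C(n, r)%:R * euler_num r)
    = 2 * (n == 0%N)%:R.
Proof.
rewrite big_nat_rev /= add0n.
under eq_big_nat => r /andP[_ rn] do
  rewrite subSS subKn // bin_sub //.
rewrite (sum_sign_even (fun r => 'C(n, r)%:R * euler_num (n - r))) /=.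
case: n => [|n]; first by rewrite big_nat1 bin0 mul1r.
rewrite big_nat_recl // subn0 bin0 mul1r euler_numE // big_add1 /=.
by rewrite addNr.
Qed.

Lemma bin_trinomial n r j : (r + j <= n)%N ->
  ('C(n, r) * 'C(n - r, j) = 'C(n, r + j) * 'C(r + j, r))%N.
Proof.
move=> rjn; have rn : (r <= n)%N by apply: leq_trans rjn; apply: leq_addr.
have := bin_fact rjn; have := bin_fact (leq_addr j r); have := bin_fact rn.
have jn : (j <= n - r)%N by rewrite leq_subRL.
have := bin_fact jn; rewrite addKn subnDA => <- <- <- e.
have f0 : (0 < r`! * (j`! * (n - r - j)`!))%N by rewrite !muln_gt0 !fact_gt0.
by apply/eqP; rewrite -(eqn_pmul2r f0); apply/eqP; nia.
Qed.

Lemma euler_binomial_sum n z :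
  \sum_(0 <= r < n.+1) 'C(n, r)%:R * (z - 1) ^+ (n - r) * euler_num r +
  \sum_(0 <= r < n.+1) 'C(n, r)%:R * (z + 1) ^+ (n - r) * euler_num r = 2 * z ^+ n.
Proof.
rewrite -big_split /=.
(* Expand both powers and index by [s = r + j], so that [z] occurs only as [z^(n-s)]. After the
   exchange of sums the inner sum is [euler_num_sum] at [s], and only [s = 0] survives. *)
transitivity (\sum_(0 <= r < n.+1) \sum_(r <= s < n.+1)
    'C(n, s)%:R * z ^+ (n - s) *
    ((1 + (-1) ^+ (s - r)) * ('C(s, r)%:R * euler_num r))).
  apply: eq_big_nat => r /andP[_ rn]; rewrite -mulrDl -mulrDr.
  rewrite -[X in index_iota X _]add0n big_addn big_mkord subSn // exprBn exprDn -big_split /=.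
  rewrite mulr_sumr mulr_suml; apply: eq_bigr => j _.
  have jn : (r + j <= n)%N by have := ltn_ord j; lia.
  rewrite !expr1n !mulr1 addnK [(j + r)%N]addnC subnDA.
  have := congr1 (fun k => k%:R : rat) (bin_trinomial jn); rewrite !natrM => e.
  rewrite -mulrnDl -[_ *+ 'C(n - r, j)]mulr_natr.
  transitivity ('C(n, r)%:R * 'C(n - r, j)%:R *
    (z ^+ (n - r - j) * ((1 + (-1) ^+ j) * euler_num r))); first by ring.
  by rewrite e; ring.
under eq_bigr => r _ do rewrite (@big_nat_widenl _ _ _ _ 0) //.
rewrite (exchange_big_dep_nat xpredT) //=.
transitivity (\sum_(0 <= s < n.+1) 'C(n, s)%:R * z ^+ (n - s) * (2 * (s == 0%N)%:R)).
  apply: eq_big_nat => s /andP[_ sn]; rewrite -euler_num_sum mulr_sumr.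
  rewrite [RHS](big_nat_widen _ _ n.+1) //.
rewrite big_nat_recl //= big1_seq ?addr0; first by rewrite bin0 subn0; ring.
by move=> s _; rewrite !mulr0.
Qed.

Lemma euler_poly_add1 n x : euler_poly n x + euler_poly n (x + 1) = 2 * x ^+ n.
Proof.
rewrite /euler_poly -mulrDr.
have -> : 2 * (x + 1) - 1 = 2 * x + 1 by ring.
rewrite euler_binomial_sum exprMn; field.
by rewrite expf_neq0.
Qed.

Lemma euler_poly_half n : euler_poly n 2^-1 = 2 ^- n * euler_num n.
Proof.
rewrite /euler_poly; congr (_ * _); rewrite mulfV // subrr.
rewrite big_nat_recr //= subnn binn !mul1r big_nat big1 ?add0r // => r /andP[_ rn].
by rewrite expr0n subn_eq0 leqNgt rn mulr0 mul0r.
Qed.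

End Euler.

(** * The ring of p-local rationals and its congruences *)

Section LocalRing.

Variable p : nat.
Hypothesis p_prime : prime p.

Local Notation "x == y [ m ]" := (pcong p m x y)
  (at level 70, y at next level, m at level 200, format "x  ==  y  [ m ]").

(** Any denominator prime to [p] will do, which gives the closure properties without computing
    lowest terms. *)
Lemma plocalP (x : rat) :
  reflect (exists2 d : nat, ~~ (p %| d)%N & x * d%:R \is a Num.int)
          (x \in plocal p).
Proof.
apply: (iffP idP) => [px | [d pd /intrP[w xd]]].
  exists `|denq x|%N => //.
  have -> : (`|denq x|%N%:R : rat) = (denq x)%:~R.
    by rewrite -[LHS]/(`|_|%N%:~R) -pmulrn natr_absz ger0_norm.
  by rewrite -{1}[x]divq_num_den divfK ?intr_eq0 ?denq_neq0 // intr_int.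
have d0 : d%:Z != 0 by apply: contra pd => /eqP [->]; rewrite dvdn0.
have -> : x = w%:~R / d%:Z%:~R.
  by rewrite -xd pmulrn mulfK ?intr_eq0.
move: pd; rewrite -[d]/(`|d%:Z|%N); case: (divqP w d%:Z) d0 => [//|k y k0 _ pd].
by rewrite inE; apply: contra pd => pd; rewrite abszM dvdn_mull.
Qed.

Fact plocal_subring : subring_closed (plocal p).
Proof.
split=> [|x y /plocalP[d pd dx] /plocalP[e pe ey]|
          x y /plocalP[d pd dx] /plocalP[e pe ey]]; apply/plocalP.
- by exists 1%N; rewrite ?rpred1 ?mulr1 // Euclid_dvd1.
- exists (d * e)%N; first by rewrite Euclid_dvdM // negb_or pd.
  have -> : (x - y) * (d * e)%:R = (x * d%:R) * e%:R - (y * e%:R) * d%:R.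
    by rewrite natrM; ring.
  by rewrite rpredB // rpredM // rpred_nat.
exists (d * e)%N; first by rewrite Euclid_dvdM // negb_or pd.
have -> : (x * y) * (d * e)%:R = (x * d%:R) * (y * e%:R) by rewrite natrM; ring.
by rewrite rpredM.
Qed.

HB.instance Definition _ :=
  GRing.isSubringClosed.Build rat (plocal p) plocal_subring.

Lemma natr_plocal (k : nat) : k%:R \in plocal p.
Proof. exact: rpred_nat. Qed.

Lemma sign_plocal (k : nat) : (-1) ^+ k \in plocal p.
Proof. by rewrite -signr_odd; case: (odd k); rewrite ?rpredN rpred1. Qed.

Lemma plocal_invn (d : nat) : ~~ (p %| d)%N -> d%:R^-1 \in plocal p.
Proof.
move=> pd; apply/plocalP; exists d => //.
by rewrite mulVf ?rpred1 // pnatr_eq0; apply: contra pd => /eqP->; rewrite dvdn0.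
Qed.

Let p0 : (p%:R : rat) != 0.
Proof. by rewrite pnatr_eq0 -lt0n prime_gt0. Qed.

Lemma pcongW m x y z : x - y = p%:R ^+ m * z -> z \in plocal p -> x == y [m].
Proof. by move=> e zp; apply/pcongP; [rewrite prime_gt0 | exists z]. Qed.

Lemma pcong_refl m x : x == x [m].
Proof. by apply: (@pcongW _ _ _ 0); rewrite ?rpred0 // subrr mulr0. Qed.

Lemma pcong_sym m x y : x == y [m] -> y == x [m].
Proof. by rewrite /pcong => h; rewrite -opprB mulNr rpredN. Qed.

Lemma pcong_trans m y x z : x == y [m] -> y == z [m] -> x == z [m].
Proof.
by rewrite /pcong => h /(rpredD h); rewrite -mulrDl addrA subrK.
Qed.

Lemma pcongD m x y x' y' : x == y [m] -> x' == y' [m] -> x + x' == y + y' [m].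
Proof.
by rewrite /pcong => h /(rpredD h); rewrite -mulrDl addrACA -opprD.
Qed.

Lemma pcongN m x y : x == y [m] -> - x == - y [m].
Proof. by rewrite /pcong => h; rewrite -opprD mulNr rpredN. Qed.

Lemma pcongMl m z x y : z \in plocal p -> x == y [m] -> z * x == z * y [m].
Proof. by rewrite /pcong => zp h; rewrite -mulrBr -mulrA rpredM. Qed.

(** Once a factor [p] is pulled out, the cofactor matters only modulo [p]; Fermat and the binomial
    congruences enter this way. *)
Lemma pcongMp m x y : x == y [m] -> p%:R * x == p%:R * y [m.+1].
Proof.
by rewrite /pcong => h; rewrite -mulrBr exprS -mulf_div divff // mul1r.
Qed.

Lemma pcongB m x y x' y' : x == y [m] -> x' == y' [m] -> x - x' == y - y' [m].
Proof. by move=> h h'; apply/pcongD/pcongN. Qed.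

Lemma pcongM m x y x' y' : x' \in plocal p -> y \in plocal p ->
  x == y [m] -> x' == y' [m] -> x * x' == y * y' [m].
Proof.
move=> px' py h h'; apply: (@pcong_trans _ (y * x')); last exact: pcongMl.
by rewrite ![_ * x']mulrC; apply: pcongMl.
Qed.

Lemma pcong0_subr m x y : (x - y == 0 [m]) = (x == y [m]).
Proof. by rewrite /pcong subr0. Qed.

Lemma pcongMnI m (d : nat) x y : ~~ (p %| d)%N ->
  d%:R * x == d%:R * y [m] -> x == y [m].
Proof.
move=> pd /(pcongMl (plocal_invn pd)).
by rewrite !mulKf // pnatr_eq0; apply: contra pd => /eqP->; rewrite dvdn0.
Qed.

Lemma plocal_inv x : x \in plocal p -> ~~ (x == 0 [1]) -> x^-1 \in plocal p.
Proof.
case/plocalP=> d pd /intrP[w xd] x0.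
have d0 : (d%:R : rat) != 0.
  by rewrite pnatr_eq0; apply: contra pd => /eqP->; rewrite dvdn0.
have xE : x = w%:~R / d%:R by rewrite -xd mulfK.
have pw : ~~ (p%:Z %| w)%Z.
  apply: contra x0 => /dvdzP[v vE].
  apply: (@pcongW _ _ _ (v%:~R / d%:R)); last by rewrite rpredM ?rpred_int ?plocal_invn.
  by rewrite subr0 xE vE intrM; ring.
apply/plocalP; exists `|w|%N => //.
have w0 : (w%:~R : rat) != 0.
  by rewrite intr_eq0; apply: contra pw => /eqP->; rewrite dvdz0.
have -> : (`|w|%N%:R : rat) = w%:~R * (sgz w)%:~R.
  by rewrite pmulrn -intrM mulrC -abszEsg.
by rewrite xE invf_div -mulrA mulKf // rpredM ?rpred_nat ?intr_int.
Qed.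

(** Neighbouring values vanish together, so a single zero spreads in both directions. *)
Lemma alternating_pcong m (d : nat -> rat) N n :
  (forall r, 0 < r <= N -> d r + d r.-1 == 0 [m])%N ->
  (n <= N)%N -> d n == 0 [m] -> forall r, (r <= N)%N -> d r == 0 [m].
Proof.
move=> dS nN dn.
have step r : (0 < r <= N)%N -> (d r == 0 [m]) = (d r.-1 == 0 [m]).
  move/dS => h; apply/idP/idP => h'; have := pcongB h h'.
    by rewrite addrC addKr subrr.
  by rewrite addrK subrr.
have d0 r : (r <= N)%N -> (d r == 0 [m]) = (d 0%N == 0 [m]).
  by elim: r => // r IH rN; rewrite step //= IH // ltnW.
by move=> r rN; rewrite d0 // -(d0 n).
Qed.

Lemma pcong_presidue a : a \in plocal p ->
  exists t, [/\ (presidue p a < p)%N, t \in plocal p &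
                a = (presidue p a)%:R + p%:R * t].
Proof.
move=> /(presidueP p_prime)[lt /(pcongP _ _ _ (prime_gt0 p_prime))[t tp e]].
by exists t; split=> //; rewrite -[p%:R]expr1 -e addrC subrK.
Qed.

(** * Fermat's theorem and binomial coefficients modulo [p] *)

Lemma fermat_plocal (r : nat) : ~~ (p %| r)%N -> r%:R ^+ p.-1 == 1 [1].
Proof.
move=> pr; have r_gt0 : (0 < r)%N by case: r pr; rewrite // dvdn0.
have /Euler_exp_totient : coprime r p by rewrite coprime_sym prime_coprime.
rewrite totient_prime // => /eqP; rewrite eqn_mod_dvd ?expn_gt0 ?r_gt0 //.
case/dvdnP=> k e.
have {e} e : (r ^ p.-1 = k * p + 1)%N.
  by rewrite -e subnK // expn_gt0 r_gt0.
apply: (@pcongW _ _ _ k%:R); last exact: rpred_nat.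
by rewrite -natrX e natrD natrM; ring.
Qed.

Lemma fermat_plocal2 : odd p -> 2 ^+ p == 2 [1].
Proof.
move=> po; have := @fermat_plocal 2.
rewrite (dvdn_prime2 p_prime) //; case: eqP => [e|_ /(_ isT) h].
  by rewrite e in po.
rewrite -[X in _ ^+ X](prednK (prime_gt0 p_prime)) exprS -[X in pcong _ _ _ X]mulr1.
by apply: pcongMl => //; apply: rpred_nat.
Qed.

Let ndvdn_ltp k : (0 < k < p)%N -> ~~ (p %| k)%N.
Proof. by case/andP=> k_gt0 kp; apply/negP => /(dvdn_leq k_gt0); rewrite leqNgt kp. Qed.

Let ndvdn_natr_neq0 k : ~~ (p %| k)%N -> (k%:R : rat) != 0.
Proof. by rewrite pnatr_eq0; apply: contra => /eqP->; rewrite dvdn0. Qed.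

Lemma bin_add_pcong j : (j < p)%N -> 'C(p + j, j)%:R == 1 [1].
Proof.
elim: j => [_|j IH jp]; first by rewrite bin0 pcong_refl.
have pj : ~~ (p %| j.+1)%N by rewrite ndvdn_ltp.
apply: (pcongMnI pj); rewrite -natrM -mul_bin_diag natrM natrD addnS mulrDl /=.
apply: (@pcong_trans _ (j.+1%:R * 'C(p + j, j)%:R)).
  apply: (@pcongW _ _ _ 'C(p + j, j)%:R); last exact: rpred_nat.
  by rewrite expr1 addrK.
by apply: pcongMl; [exact: rpred_nat | apply: IH; exact: ltnW].
Qed.

(** Two neighbours [C(p-1, k)] and [C(p-1, k+1)] add up to [C(p, k+1)], a multiple of [p]. *)
Lemma bin_pred_pcong k : (k < p)%N -> 'C(p.-1, k)%:R == (-1) ^+ k [1].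
Proof.
elim: k => [_|k IH kp]; first by rewrite bin0 pcong_refl.
have /(prime_dvd_bin p_prime)/dvdnP[c] : (0 < k.+1 < p)%N by [].
rewrite -{1}(prednK (prime_gt0 p_prime)) binS => e.
have -> : 'C(p.-1, k.+1)%:R = c%:R * p%:R - 'C(p.-1, k)%:R :> rat.
  by rewrite -natrM -e natrD addrK.
rewrite exprS mulN1r -[X in pcong _ _ _ X]add0r.
apply: pcongB; last by apply: IH; apply: ltnW.
by apply: (@pcongW _ _ _ c%:R); rewrite ?rpred_nat // subr0 mulrC.
Qed.

(** * Functions of [c + p t] that are affine in [t] modulo [p^2] *)

Definition plinear (c : rat) (f : rat -> rat) := exists A B,
  [/\ A \in plocal p, B \in plocal p &
      forall t, t \in plocal p -> f (c + p%:R * t) == A + p%:R * t * B [2]].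

Section Plinear.

Variable c : rat.
Implicit Types f g : rat -> rat.

Lemma plinear_ext f g : f =1 g -> plinear c f -> plinear c g.
Proof. by move=> e [A [B [? ? h]]]; exists A, B; split=> // t; rewrite -e; exact: h. Qed.

Lemma plinear_cst d : d \in plocal p -> plinear c (fun=> d).
Proof.
by exists d, 0; split; rewrite ?rpred0 // => t _; rewrite mulr0 addr0 pcong_refl.
Qed.

Lemma plinear_id : c \in plocal p -> plinear c id.
Proof.
by exists c, 1; split; rewrite ?rpred1 // => t _; rewrite mulr1 pcong_refl.
Qed.

Lemma plinearD f g : plinear c f -> plinear c g -> plinear c (fun x => f x + g x).
Proof.
move=> [A [B [pA pB hf]]] [A' [B' [pA' pB' hg]]]; exists (A + A'), (B + B').
split=> [||t tp]; rewrite ?rpredD // mulrDr addrACA.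
by apply: pcongD; [exact: hf | exact: hg].
Qed.

Lemma plinearM f g : plinear c f -> plinear c g -> plinear c (fun x => f x * g x).
Proof.
move=> [A [B [pA pB hf]]] [A' [B' [pA' pB' hg]]]; exists (A * A'), (A * B' + A' * B).
split=> [||t tp]; rewrite ?rpredD ?rpredM //.
have /(pcongP _ _ _ (prime_gt0 p_prime)) [u pu eu] := hf t tp.
have /(pcongP _ _ _ (prime_gt0 p_prime)) [v pv ev] := hg t tp.
have pp := natr_plocal p.
(* The witness collects all terms of the product that carry [p^2], where [u] and [v] are the errors
   of [f] and [g]. *)
apply: (@pcongW _ _ _ (u * (A' + p%:R * t * B') + v * (A + p%:R * t * B)
   + p%:R ^+ 2 * u * v + t ^+ 2 * B * B')); last first.
  by rewrite !(rpredD, rpredM, rpredX).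
rewrite -[f _](subrK (A + p%:R * t * B)) eu.
by rewrite -[g _](subrK (A' + p%:R * t * B')) ev; ring.
Qed.

Lemma plinear_sum (F : nat -> rat -> rat) n :
  (forall k, (k < n)%N -> plinear c (F k)) ->
  plinear c (fun x => \sum_(0 <= k < n) F k x).
Proof.
elim: n => [_|n IH h].
  by apply: (@plinear_ext (fun=> 0)) (plinear_cst (natr_plocal 0)) => x; rewrite big_nil.
apply: (@plinear_ext (fun x => \sum_(0 <= k < n) F k x + F n x)).
  by move=> x; rewrite big_nat_recr.
by apply: plinearD; [apply: IH => k kn; apply: h; apply: ltnW | exact: h].
Qed.

(** The bound [k < p] makes all factors of [k!] invertible modulo [p]. *)
Lemma plinear_rbinom g k : (k < p)%N -> plinear c g ->
  plinear c (fun x => rbinom (g x) k).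
Proof.
move=> + hg; elim: k => [_|k IH kp].
  by apply: (@plinear_ext (fun=> 1)) (plinear_cst (natr_plocal 1)) => x; rewrite rbinom0.
apply: (@plinear_ext (fun x => rbinom (g x) k * ((g x + - k%:R) * k.+1%:R^-1))).
  by move=> x; rewrite rbinomS mulrA.
apply: plinearM; first by apply: IH; apply: ltnW.
apply: plinearM; last by apply/plinear_cst/plocal_invn/ndvdn_ltp.
by apply: plinearD => //; apply: plinear_cst; rewrite rpredN rpred_nat.
Qed.

(** The values at [t = 0] and [t = 1] recover [A] and [A + p B], so a finite difference serves as
    the slope. *)
Lemma plinear_diff f t : t \in plocal p -> plinear c f ->
  f (c + p%:R * t) == f c + t * (f (c + p%:R) - f c) [2].
Proof.
move=> tp [A [B [pA pB h]]].
have h0 := h _ (natr_plocal 0); have h1 := h _ (natr_plocal 1).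
rewrite mulr0 mul0r !addr0 in h0; rewrite mulr1 in h1.
apply: (pcong_trans (h t tp)).
have -> : A + p%:R * t * B = A + t * (A + p%:R * B - A) by ring.
apply/pcong_sym/pcongD => //.
by apply/pcongMl/pcongB.
Qed.

End Plinear.

Lemma plinear_binom_pow_sum m c : (m < p)%N -> c \in plocal p ->
  plinear c (binom_pow_sum m).
Proof.
move=> mp pc; apply: plinear_sum => k km; apply: plinearM.
  by apply: plinear_rbinom; [exact: leq_trans km mp | exact: plinear_id].
by apply: plinear_cst; rewrite rpredX // rpredN rpred_nat.
Qed.

Lemma plinear_binom_prod_sum m c : (m < p)%N -> c \in plocal p ->
  plinear c (binom_prod_sum m).
Proof.
move=> mp pc; apply: plinear_sum => k km.
apply: plinearM; apply: plinear_rbinom; try exact: leq_trans km mp.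
  exact: plinear_id.
apply: (@plinear_ext _ (fun x => -1 + -1 * x)); first by move=> x; rewrite mulN1r.
have p1 : -1 \in plocal p by rewrite rpredN rpred1.
by apply/plinearD/plinearM; [exact: plinear_cst.. | exact: plinear_id].
Qed.

Lemma euler_num_plocal m : euler_num m \in plocal p.
Proof. by have /intrP[w ->] := euler_num_int m; apply: rpred_int. Qed.

(** * Slopes of the two sums for [p = 2n+1] *)

Section HalfPrime.

Variable n : nat.
Hypothesis pE : p = n.*2.+1.

Local Notation L := (binom_prod_sum n).
Local Notation S := (binom_pow_sum p.-1).

Let p_gt0 : (0 < p)%N := prime_gt0 p_prime.
Let n_gt0 : (0 < n)%N. Proof. by move: (prime_gt1 p_prime); rewrite pE; case: (n). Qed.
Let pred_p : p.-1 = n.*2. Proof. by rewrite pE. Qed.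
Let predp_lt : (p.-1 < p)%N. Proof. by rewrite pE. Qed.
Let n_lt : (n < p)%N. Proof. by rewrite pE ltnS -addnn leq_addr. Qed.
Let sign_predp : (-1) ^+ p.-1 = 1 :> rat.
Proof. by rewrite pred_p -signr_odd odd_double. Qed.
Let pos_predp : (-2) ^+ p.-1 = 2 ^+ p.-1 :> rat.
Proof. by rewrite exprNn sign_predp mul1r. Qed.
Let predpK : 2 * 2 ^+ p.-1 = 2 ^+ p :> rat.
Proof. by rewrite -exprS prednK. Qed.

Definition pow_sum_slope (r : nat) : rat := S (r%:R + p%:R) - S r%:R.
Local Notation q := pow_sum_slope.

(** The recurrence at [a = p] yields [S(p)] from [S(p-1) = 1]. *)
Lemma pow_sum_slope0 : q 0 = 2 ^+ p - 2.
Proof.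
have := binom_pow_sum_rec p.-1 p%:R.
have -> : (p%:R : rat) - 1 = p.-1%:R by rewrite -(prednK p_gt0) -natr1 addrK.
rewrite (binom_pow_sum_nat (leqnn _)) sign_predp rbinom_nat binn mul1r pos_predp predpK => e.
by rewrite /q add0r (binom_pow_sum_nat (leq0n _)) expr0 -e; ring.
Qed.

(** In the recurrence at [r + p] the unshifted values cancel, leaving [2^p C(r+p-1, p-1)]. Times [r]
    this is [p 2^p C(p+r-1, r-1)], whose cofactor of [p] is 2 modulo [p]. *)
Lemma pow_sum_slope_rec r : (0 < r < p)%N -> q r + q r.-1 == 2 * (p%:R / r%:R) [2].
Proof.
case: r => [|r] // /andP[_ rp]; rewrite /q succnK.
have := binom_pow_sum_rec p.-1 (r.+1%:R + p%:R).
have -> : r.+1%:R + p%:R - 1 = r%:R + p%:R :> rat by rewrite -natr1; ring.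
rewrite -(natrD _ r p) rbinom_nat pos_predp => e.
have rp1 : (r < p.-1)%N by rewrite -ltnS prednK.
have -> : S (r.+1%:R + p%:R) - S r.+1%:R + (S (r + p)%:R - S r%:R)
   = 2 ^+ p * 'C(r + p, p.-1)%:R.
  rewrite -predpK (binom_pow_sum_nat rp1) (binom_pow_sum_nat (ltnW rp1)) exprS.
  transitivity (S (r.+1%:R + p%:R) + S (r + p)%:R); first by ring.
  by rewrite e; ring.
have r1 := ndvdn_ltp (rp : 0 < r.+1 < p)%N.
have e' : (r.+1 * 'C(r + p, p.-1) = p * 'C(p + r, r))%N.
  rewrite -(@bin_sub (r + p)); last by lia.
  have -> : (r + p - p.-1 = r.+1)%N by lia.
  by rewrite mul_bin_left addnC addnK.
apply: (pcongMnI r1).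
have -> : r.+1%:R * (2 ^+ p * 'C(r + p, p.-1)%:R) = p%:R * (2 ^+ p * 'C(p + r, r)%:R) :> rat.
  by rewrite mulrCA -natrM e' natrM mulrCA.
have -> : r.+1%:R * (2 * (p%:R / r.+1%:R)) = p%:R * (2 * 1) :> rat.
  by rewrite mulrCA [_ * (p%:R / _)]mulrC divfK ?ndvdn_natr_neq0 // mulr1 mulrC.
apply/pcongMp/pcongM; rewrite ?rpred_nat //.
  by apply: fermat_plocal2; rewrite pE /= odd_double.
exact/bin_add_pcong/ltnW.
Qed.

(** Compute [S(-1)] twice: exactly, from the recurrence at 0, and modulo [p^2], by linearity at
    [-1 = (p-1) + p (-1)]. *)
Lemma pow_sum_slope_last : q p.-1 + q 0 == 0 [2].
Proof.
have p1 : -1 \in plocal p by rewrite rpredN rpred1.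
have pc : p.-1%:R \in plocal p by rewrite rpred_nat.
have := plinear_diff p1 (plinear_binom_pow_sum predp_lt pc).
have -> : p.-1%:R + p%:R * -1 = 0 - 1 :> rat.
  by rewrite -(prednK p_gt0) succnK -natr1; ring.
have := binom_pow_sum_rec p.-1 0; rewrite sub0r rbinomN.
have -> : 1 + p.-1%:R - 1 = p.-1%:R :> rat by rewrite addrC addKr.
rewrite rbinom_nat binn sign_predp !mul1r pos_predp predpK (binom_pow_sum_nat (leq0n _)).
rewrite expr0 => /(canRL (addKr _)) ->.
rewrite /q (binom_pow_sum_nat (leqnn _)) sign_predp -/(q 0) pow_sum_slope0 => h.
move: h; rewrite -pcong0_subr; congr (pcong _ _ _ _); ring.
Qed.

(** Consecutive values of the sum add up to [2p/r + 2p/(p-r) = 2p^2/(r(p-r))], which vanishes modulo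
    [p^2]; the zero to start from is at [r = 0]. *)
Lemma pow_sum_slope_sym r : (r < p)%N -> q r + q (p.-1 - r) == 0 [2].
Proof.
move=> rp; pose d r := q r + q (p.-1 - r).
apply: (@alternating_pcong 2 d p.-1 0); last by rewrite -ltnS prednK.
- case=> [|s] // /andP[_ sp]; rewrite /d succnK.
  have sp' : (0 < s.+1 < p)%N by lia.
  have sp2 : (0 < p - s.+1 < p)%N by lia.
  have := pcongD (pow_sum_slope_rec sp') (pow_sum_slope_rec sp2).
  have -> : (p - s.+1).-1 = (p.-1 - s.+1)%N by lia.
  have -> : (p.-1 - s)%N = (p - s.+1)%N by lia.
  rewrite succnK => h.
  apply: (@pcong_trans _ (2 * (p%:R / s.+1%:R) + 2 * (p%:R / (p - s.+1)%:R))).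
    by move: h; congr (pcong _ _ _ _); ring.
  apply: (@pcongW _ _ _ (2 * (s.+1%:R^-1 * (p - s.+1)%:R^-1))).
    have := ndvdn_natr_neq0 (ndvdn_ltp sp'); have := ndvdn_natr_neq0 (ndvdn_ltp sp2).
    rewrite natrB; last by lia.
    by move: p%:R s.+1%:R => P X PX0 X0; field; rewrite PX0 X0.
  by rewrite !rpredM ?rpred_nat // plocal_invn // ndvdn_ltp.
- by [].
by rewrite /d subn0 addrC pow_sum_slope_last.
Qed.

(** The index [n] is fixed by [r -> p-1-r], and 2 is invertible. *)
Lemma pow_sum_slope_mid : q n == 0 [2].
Proof.
have := pow_sum_slope_sym n_lt; rewrite pred_p -addnn addnK => h.
have p2 : ~~ (p %| 2)%N by rewrite dvdn_prime2 // pE; case: (n) => [|[]].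
by apply: (pcongMnI p2); rewrite mulr0 mulr_natl mulr2n.
Qed.

(* The shift is by [- p] because the reflection [x -> -1 - x], under which [L]
   is invariant, maps [n - p] to [n]; so [m r] is minus the slope of [L]. *)
Definition prod_sum_slope (r : nat) : rat := L (r%:R - p%:R) - L r%:R.
Local Notation m := prod_sum_slope.

Lemma prod_sum_slope_rec r : (0 < r <= n)%N ->
  m r + m r.-1 == - (2 * (p%:R / r%:R)) [2].
Proof.
case: r => [|r] // /andP[_ rn]; rewrite /m succnK.
have := binom_prod_sum_rec n (r.+1%:R - p%:R).
have -> : r.+1%:R - p%:R - 1 = r%:R - p%:R :> rat by rewrite -natr1; ring.
(* With this [j] the two binomials become, up to sign, [C(p+j, n)] and [C(n+j, n)], the shape of
   [bin_mul_exchange]. *)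
pose j := (n - r.+1)%N.
have -> : r%:R - p%:R = - (p - r)%:R :> rat by rewrite natrB ?opprB //; lia.
have -> : -1 - (r.+1%:R - p%:R) = (n + j)%:R :> rat.
  have -> : (n + j = p - r.+2)%N by rewrite /j; lia.
  by rewrite natrB ?pE; [rewrite -(natr1 r.+1); ring | lia].
rewrite rbinomN; have -> : (p - r)%:R + n%:R - 1 = (p + j)%:R :> rat.
  have e : (p - r + n = (p + j).+1)%N by rewrite /j; lia.
  by rewrite -natrD e -natr1 addrK.
rewrite !rbinom_nat => e.
set X := (X in X == _ [_]).
have {e} -> : X = 2 * ((-1) ^+ n * 'C(p + j, n)%:R * 'C(n + j, n)%:R).
  rewrite -e /X; rewrite !binom_prod_sum_nat ?(ltnW rn) // exprS; ring.
have e' : ('C(p + j, n) * 'C(n + j, n) * (p - r.+1) = p * ('C(p + j, j) * 'C(p.-1, n)))%N.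
  rewrite pred_p; have -> : (p - r.+1 = (n + j).+1)%N by rewrite /j; lia.
  by rewrite pE bin_mul_exchange.
have sp' : (0 < r.+1 < p)%N by lia.
have sp2 : (0 < p - r.+1 < p)%N by lia.
apply: (pcongMnI (ndvdn_ltp sp2)).
have -> : (p - r.+1)%:R * (2 * ((-1) ^+ n * 'C(p + j, n)%:R * 'C(n + j, n)%:R)) =
   p%:R * (2 * ((-1) ^+ n * ('C(p + j, j)%:R * 'C(p.-1, n)%:R))) :> rat.
  transitivity (2 * (-1) ^+ n * ('C(p + j, n) * 'C(n + j, n) * (p - r.+1))%:R : rat).
    by rewrite !natrM; ring.
  by rewrite e' !natrM; ring.
apply: (@pcong_trans _ (p%:R * (2 * ((-1) ^+ n * (1 * (-1) ^+ n))))).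
  apply/pcongMp/pcongMl/pcongMl/pcongM; rewrite ?natr_plocal ?sign_plocal //.
  - exact: (natr_plocal 1).
  - by apply: bin_add_pcong; rewrite /j; lia.
  - exact: bin_pred_pcong.
rewrite mul1r -exprMn mulrNN mulr1 expr1n mulr1.
(* With [s = r + 1]: [2p + (p-s) 2p/s = p^2 (2/s)]. *)
apply: (@pcongW _ _ _ (2 / r.+1%:R)).
  have := ndvdn_natr_neq0 (ndvdn_ltp sp'); rewrite natrB; last by lia.
  by move: p%:R r.+1%:R => P Y Y0; field.
by rewrite rpredM ?rpred_nat // plocal_invn // ndvdn_ltp.
Qed.

(** The two recurrences cancel, and at [r = n] both slopes vanish, [m n] exactly by reflection. *)
Lemma slope_opp r : (r <= n)%N -> m r + q r == 0 [2].
Proof.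
pose d r := m r + q r.
apply: (@alternating_pcong 2 d n n) => // [s /andP[s_gt0 sn]|].
  have sp : (0 < s < p)%N by rewrite s_gt0 (leq_ltn_trans sn).
  have sn' : (0 < s <= n)%N by rewrite s_gt0.
  have := pcongD (prod_sum_slope_rec sn') (pow_sum_slope_rec sp).
  by rewrite addNr addrACA.
rewrite /d /m -binom_prod_sum_sym.
have -> : -1 - (n%:R - p%:R) = n%:R :> rat by rewrite pE -natr1 -addnn natrD; ring.
by rewrite subrr add0r pow_sum_slope_mid.
Qed.

Lemma prod_sum_slope_pcong r t : (r <= n)%N -> t \in plocal p ->
  L (r%:R + p%:R * t) == (-1) ^+ r + t * q r [2].
Proof.
move=> rn tp; have rp := natr_plocal r.
have p1 : -1 \in plocal p by rewrite rpredN rpred1.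
have lin := plinear_binom_prod_sum n_lt rp.
apply: (pcong_trans (plinear_diff tp lin)); rewrite binom_prod_sum_nat //.
apply/pcongD/(pcongMl tp); first exact: pcong_refl.
have := slope_opp rn; rewrite /m binom_prod_sum_nat // => h.
(* Linearity at [t = -1] turns the shift by [- p] into minus the shift by [p]. *)
have := plinear_diff p1 lin; rewrite mulrN1 binom_prod_sum_nat // -pcong0_subr => h'.
rewrite -pcong0_subr; move: (pcongB h' h); rewrite subrr.
by congr (pcong _ _ _ _); ring.
Qed.

Lemma pow_sum_slope_pcong r t : (r < p)%N -> t \in plocal p ->
  S (r%:R + p%:R * t) == (-1) ^+ r + t * q r [2].
Proof.
move=> rp tp; rewrite -(@binom_pow_sum_nat p.-1); last by rewrite -ltnS prednK.
by apply/(plinear_diff tp)/plinear_binom_pow_sum; rewrite ?rpred_nat.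
Qed.

(** Reflection sends [r + p t] to [(p-1-r) + p (-(1+t))], whose residue is below [n]; antisymmetry
    of [q] restores the sign, and [p-1] is even. *)
Lemma prod_sum_slope_pcong_upper r t : (n < r < p)%N -> t \in plocal p ->
  L (r%:R + p%:R * t) == (-1) ^+ r + (1 + t) * q r [2].
Proof.
case/andP=> nr rp tp; rewrite -binom_prod_sum_sym.
have -> : -1 - (r%:R + p%:R * t) = (p.-1 - r)%:R + p%:R * (- (1 + t)).
  rewrite natrB; last by lia.
  have -> : (p%:R : rat) = p.-1%:R + 1 by rewrite natr1 prednK.
  by ring.
have t1 : - (1 + t) \in plocal p by rewrite rpredN rpredD ?rpred1.
apply: pcong_trans (prod_sum_slope_pcong _ t1) _; first by lia.
rewrite -signr_odd oddB; last by lia.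
rewrite pred_p odd_double addFb signr_odd mulNr -mulrN.
apply/pcongD/pcongMl; rewrite ?pcong_refl ?rpredD ?rpred1 //.
rewrite -pcong0_subr -pred_p; move: (pcongN (pow_sum_slope_sym rp)); rewrite oppr0.
by congr (pcong _ _ _ _); ring.
Qed.

(** * The slope as an Euler polynomial value, and the upper residues *)

Local Notation E := (euler_poly (p - 2)).

Let pow_half_plocal k : 2 ^- k \in plocal p.
Proof.
rewrite -exprVn rpredX // plocal_invn // dvdn_prime2 // pE.
by case: (n) => [|[]].
Qed.

Lemma euler_poly_pcong k x y : x \in plocal p -> y \in plocal p ->
  x == y [1] -> euler_poly k x == euler_poly k y [1].
Proof.
move=> xp yp xy; apply: pcongMl; first exact: pow_half_plocal.
have px z : z \in plocal p -> 2 * z - 1 \in plocal p.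
  by move=> zp; rewrite rpredB ?rpred1 // rpredM ?natr_plocal.
have xy' : 2 * x - 1 == 2 * y - 1 [1].
  by apply: pcongB (pcong_refl _ _); apply: pcongMl; rewrite ?natr_plocal.
have powP j : (2 * x - 1) ^+ j == (2 * y - 1) ^+ j [1].
  elim: j => [|j IH]; first exact: pcong_refl.
  by rewrite !exprS; apply: pcongM => //; rewrite ?rpredX ?px.
elim: k.+1 => [|m IH]; first by rewrite !big_nil pcong_refl.
rewrite !big_nat_recr //=; apply: pcongD => //.
rewrite ![_ * euler_num _]mulrC; apply: pcongMl; first exact: euler_num_plocal.
by apply: pcongMl; first exact: natr_plocal.
Qed.

Lemma euler_poly_plocal k x : x \in plocal p -> euler_poly k x \in plocal p.
Proof.
move=> xp; rewrite rpredM ?pow_half_plocal // rpred_sum // => r _.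
by rewrite !rpredM ?natr_plocal ?euler_num_plocal // rpredX // rpredB ?rpred1 //
  rpredM ?natr_plocal.
Qed.

Lemma euler_poly_slope r : (r < p)%N -> q r + p%:R * E (- r%:R) == 0 [2].
Proof.
pose d s := q s + p%:R * E (- s%:R).
move=> rp; apply: (@alternating_pcong 2 d p.-1 n); last by rewrite -ltnS prednK.
- case=> [|s] // /andP[_ sp]; rewrite /d succnK.
  have sp' : (0 < s.+1 < p)%N by lia.
  have s1 := ndvdn_ltp sp'.
  have := euler_poly_add1 (p - 2) (- s.+1%:R).
  have -> : - s.+1%:R + 1 = - s%:R :> rat by rewrite -natr1; ring.
  move=> e; apply: (pcongMnI s1).
  have := pcongMl (natr_plocal s.+1) (pow_sum_slope_rec sp'); rewrite succnK => h1.
  have h2 := pcongMp (pcongMl (natr_plocal 2) (fermat_plocal s1)).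
  (* As [p - 2] is odd, the sign comes out and the power becomes the one in Fermat's theorem. *)
  have rE : s.+1%:R ^+ p.-1 = - (s.+1%:R * (- s.+1%:R) ^+ (p - 2)) :> rat.
    have -> : p.-1 = (p - 2).+1 by lia.
    rewrite exprNn -signr_odd oddB; last by lia.
    by rewrite pE /= odd_double mulN1r mulrN opprK exprS.
  have -> : s.+1%:R * (q s.+1 + p%:R * E (- s.+1%:R) + (q s + p%:R * E (- s%:R))) =
      s.+1%:R * (q s.+1 + q s) - p%:R * (2 * s.+1%:R ^+ p.-1).
    rewrite rE; transitivity (s.+1%:R * (q s.+1 + q s) +
        p%:R * s.+1%:R * (E (- s.+1%:R) + E (- s%:R))); first by ring.
    by rewrite e; ring.
  have -> : s.+1%:R * 0 = s.+1%:R * (2 * (p%:R / s.+1%:R)) - p%:R * (2 * 1) :> rat.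
    have := ndvdn_natr_neq0 s1; move: p%:R s.+1%:R => P X X0.
    by field.
  exact: pcongB h1 h2.
- by rewrite pE /= -addnn leq_addr.
rewrite /d -[0]addr0; apply: pcongD; first exact: pow_sum_slope_mid.
rewrite -[0](mulr0 p%:R); apply: pcongMp.
(* At the midpoint, [-n = 1/2 - p/2] reduces to [1/2], where the value is a multiple of an Euler
   number of odd index. *)
have <- : E 2^-1 = 0.
  rewrite euler_poly_half euler_num_odd ?mulr0 //.
  by rewrite oddB ?pE /= ?odd_double //; lia.
have h2 : ~~ (p %| 2)%N by rewrite dvdn_prime2 // pE; case: (n) => [|[]].
apply: euler_poly_pcong; rewrite ?rpredN ?natr_plocal ?plocal_invn //.
apply: (@pcongW _ _ _ (- 2^-1)); last by rewrite rpredN plocal_invn.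
by rewrite pE -(natr1 n.*2) -addnn natrD; field.
Qed.

(** Since [t] is invertible, [q r] can be eliminated between the congruences for [L] and [S]. *)
Lemma prod_sum_pcong_unit r t : (n < r < p)%N -> t \in plocal p -> ~~ (t == 0 [1]) ->
  L (r%:R + p%:R * t) ==
    (1 + 1 / t) * S (r%:R + p%:R * t) - (-1) ^+ r * (1 / t) [2].
Proof.
move=> nrp tp t0; have t0' : t != 0 by apply: contra t0 => /eqP->; apply: pcong_refl.
apply: (pcong_trans (prod_sum_slope_pcong_upper nrp tp)).
have -> : (-1) ^+ r + (1 + t) * q r =
    (1 + 1 / t) * ((-1) ^+ r + t * q r) - (-1) ^+ r * (1 / t) by field.
apply/pcongB/pcong_refl/pcongMl.
  by rewrite rpredD ?rpred1 // mul1r plocal_inv.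
by case/andP: nrp => _ rp; apply/pcong_sym/pow_sum_slope_pcong.
Qed.

(** The slope carries a factor [p], so its cofactors count only modulo [p]: [1 + t] becomes 1, and
    [-r] may be replaced by [-a]. *)
Lemma prod_sum_pcong_nonunit r t : (n < r < p)%N -> t \in plocal p -> t == 0 [1] ->
  L (r%:R + p%:R * t) == (-1) ^+ r - p%:R * E (- (r%:R + p%:R * t)) [2].
Proof.
move=> nrp tp t0; have [_ rp] := andP nrp.
apply: (pcong_trans (prod_sum_slope_pcong_upper nrp tp)).
apply: pcongD; first exact: pcong_refl.
have nrl : - r%:R \in plocal p by rewrite rpredN natr_plocal.
have al : - (r%:R + p%:R * t) \in plocal p.
  by rewrite rpredN rpredD ?rpredM ?natr_plocal.
have q_eq : q r == - (p%:R * E (- r%:R)) [2].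
  by rewrite -pcong0_subr opprK euler_poly_slope.
apply: (pcong_trans (pcongMl _ q_eq)); first by rewrite rpredD ?rpred1.
rewrite mulrN mulrCA; apply/pcongN/pcongMp.
rewrite -[X in _ == X [_]]mul1r; apply: pcongM.
- exact: euler_poly_plocal.
- exact: (natr_plocal 1).
- by rewrite -[X in _ == X [_]]addr0; apply: pcongD t0; apply: pcong_refl.
apply: euler_poly_pcong => //; apply: (@pcongW _ _ _ t) => //.
by rewrite opprK addrA addNr add0r.
Qed.

End HalfPrime.
End LocalRing.

Unset Implicit Arguments.

Theorem theorem3p1 (p : nat) (a : rat) :
  prime p -> (3 < p)%N -> a \in plocal p -> ~~ pcong p 1 a 0 ->
  let r : nat := presidue p a in
  let t : rat := (a - r%:R) / p%:R in
  let L : rat :=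
    \sum_(0 <= k < ((p - 1) %/ 2).+1) rbinom a k * rbinom (-1 - a) k in
  let S : rat := \sum_(0 <= k < (p - 1).+1) rbinom a k * (-2) ^+ k in
  [/\ (r <= (p - 1) %/ 2)%N -> pcong p 2 L S,
      (r > (p - 1) %/ 2)%N -> ~~ pcong p 1 t 0 ->
        pcong p 2 L ((1 + 1 / t) * S - (-1) ^+ r * (1 / t))
    & (r > (p - 1) %/ 2)%N -> pcong p 1 t 0 ->
        pcong p 2 L ((-1) ^+ r - p%:R * euler_poly (p - 2) (- a))].
Proof.
move=> pp p_gt3 pa _ r t.
pose n := ((p - 1) %/ 2)%N.
have pE : p = n.*2.+1.
  have op : odd p by case: (even_prime pp) => // p2; rewrite p2 in p_gt3.
  by rewrite /n; lia.
have [t' [rp t'p aE]] := pcong_presidue pp pa; rewrite -/r in rp aE.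
have p0 : (p%:R : rat) != 0 by rewrite pnatr_eq0 -lt0n prime_gt0.
(* The quotient [t] of the statement is the p-local [t'] of the decomposition [a = r + p t']. *)
have tE : t = t' by rewrite /t {1}aE addrC addKr mulrC mulKf.
rewrite -tE in t'p aE.
have p1 : (p - 1 = p.-1)%N by rewrite subn1.
rewrite /= -/n -[X in pcong p 2 X]/(binom_prod_sum n a) p1 -/(binom_pow_sum p.-1 a).
split=> [rn | nr tn0 | nr t0].
- rewrite aE; apply: (pcong_trans pp) (prod_sum_slope_pcong pp pE rn t'p) _.
  exact/(pcong_sym pp)/(pow_sum_slope_pcong pp pE rp t'p).
- by rewrite aE; apply: (prod_sum_pcong_unit pp pE) => //; rewrite nr.
by rewrite aE; apply: (prod_sum_pcong_nonunit pp pE) => //; rewrite nr.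
Qed.
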